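(* If there exists an irreducible $(n,3)$-homogeneous subcube partition then $n=4$. Moreover, the irreducible $(4,3)$-homogeneous subcube partition is unique up to permutation of coordinates and flipping of coordinates (exchanging $0$ and $1$ in a coordinate).
   Context: Subcubes of $\{0,1\}^n$ are identified with words in $\{0,1,*\}^n$; the codimension is the number of non-$*$ positions. A subcube partition of length $n$ is a partition of $\{0,1\}^n$ into subcubes; it is irreducible if no subset $G$ with $1<|G|<|F|$ has a union that is a subcube, and tight if for every coordinate $i$ some subcube $s$ has $s_i\ne*$. An $(n,k)$-homogeneous subcube partition is a tight subcube partition of length $n$ all of whose subcubes have codimension $k$. *)

(* Defs.v *)
From mathcomp Require Import all_boot all_fingroup.

Set Implicit Arguments.
Unset Strict Implicit.
Unset Printing Implicit Defensive.

(* Words over {0,1,*}; [None] is [*]. *)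
Notation word n := {ffun 'I_n -> option bool}.

Definition subcube n (s : word n) : {set {ffun 'I_n -> bool}} :=
  [set x : {ffun 'I_n -> bool} | [forall i, (s i == None) || (s i == Some (x i))]].

Definition codim n (s : word n) : nat := #|[set i | s i != None]|.

(* [subcube] is injective with nonempty values, so a set of words carries the
   same data as the set of the subcubes they denote. *)
Definition subcube_partition n (F : {set word n}) : bool :=
  partition [set subcube s | s in F] [set: {ffun 'I_n -> bool}].

Definition irreducible n (F : {set word n}) : Prop :=
  forall G : {set word n}, G \subset F -> 1 < #|G| < #|F| ->
  ~ exists t : word n, \bigcup_(s in G) subcube s = subcube t.

Definition tight n (F : {set word n}) : Prop :=
  forall i : 'I_n, exists2 s, s \in F & s i != None.

Definition homogeneous n k (F : {set word n}) : Prop :=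
  [/\ subcube_partition F, tight F & forall s, s \in F -> codim s = k].

(* Permute the coordinates by [p], then flip those [i] with [b i = true];
   [omap] leaves the stars alone. *)
Definition perm_flip n (p : 'S_n) (b : {ffun 'I_n -> bool}) (s : word n) :
    word n :=
  [ffun i => omap (addb (b i)) (s (p i))].

Definition equivalent n (F F' : {set word n}) : Prop :=
  exists (p : 'S_n) (b : {ffun 'I_n -> bool}),
    F' = [set perm_flip p b s | s in F].

(* Main.v *)
(* Since all members have codimension 3, there are 8 of them, mentioning 24
   coordinates in total.  Flipping a coordinate [i] exchanges the regions covered
   by the members with value 0 and with value 1 at [i]; if one of these two
   families had at most two members, two members of the partition would be
   mirror images of each other, and their union would be a subcube.  So every
   coordinate is mentioned at least 6 times and n <= 4.  For n = 3 all members
   are points, and two adjacent points form a subcube.  For n = 4 all partitions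
   are enumerated by an exact-cover search. *)
Require Import Defs.
From mathcomp Require Import all_boot all_fingroup.

Set Implicit Arguments.
Unset Strict Implicit.
Unset Printing Implicit Defensive.

(** * Words as subcubes: inclusion, disjointness, cardinality, reflection *)

Section Subcubes.
Variable n : nat.
Implicit Types (s t : word n) (x y : {ffun 'I_n -> bool}) (i j : 'I_n).

Definition subword s t : bool := [forall i, (t i == None) || (t i == s i)].

Definition compatible s t : bool :=
  [forall i, [|| s i == None, t i == None | s i == t i]].

Definition flip_point i x : {ffun 'I_n -> bool} := [ffun j => (j == i) (+) x j].

Definition flip_word i s : word n := [ffun j => omap (addb (j == i)) (s j)].

Lemma in_subcubeP s x :
  reflect (forall i b, s i = Some b -> x i = b) (x \in subcube s).
Proof.
rewrite inE; apply: (iffP forallP) => sx i.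
  by move=> b si; move: (sx i); rewrite si => /eqP[].
by case si: (s i) => [b|] //=; rewrite (sx _ _ si).
Qed.

Lemma subcube_subset s t : (subcube s \subset subcube t) = subword s t.
Proof.
apply/subsetP/forallP => [st i | st x /in_subcubeP sx]; last first.
  apply/in_subcubeP => i b ti; apply: sx; move: (st i).
  by rewrite ti /= => /eqP ->.
case ti: (t i) => [b|] //=.
(* This point of [subcube s] disagrees with [t] wherever [s] has a star and [t] does not, so it lies
   in [subcube t] only if [s] fixes those coordinates too. *)
pose x := [ffun j => odflt (~~ odflt false (t j)) (s j)].
have /st/in_subcubeP/(_ _ _ ti) : x \in subcube s.
  by apply/in_subcubeP => j c sj; rewrite ffunE sj.
by rewrite ffunE ti /=; case: (s i) => [c /= ->|] //; case: (b).
Qed.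

Lemma subcube_inj : injective (@subcube n).
Proof.
move=> s t st; apply/ffunP => i.
have /forallP/(_ i) : subword s t by rewrite -subcube_subset st.
have /forallP/(_ i) : subword t s by rewrite -subcube_subset st.
by case: (s i) (t i) => [a|] [b|] //= /eqP.
Qed.

Lemma disjoint_subcube s t :
  [disjoint subcube s & subcube t] = ~~ compatible s t.
Proof.
apply/idP/idP => [|/forallPn[i]].
  apply: contraL => /forallP st; rewrite -setI_eq0; apply/set0Pn.
  exists [ffun i => odflt (odflt false (t i)) (s i)]; rewrite inE.
  apply/andP; split; apply/in_subcubeP => i b; rewrite ffunE => e; move: (st i).
    by rewrite e.
  by rewrite e; case: (s i) => //= c /eqP[].
rewrite !negb_or => /and3P[si ti st]; rewrite -setI_eq0; apply/eqP/setP => x.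
rewrite !inE; apply/negP => /andP[/forallP/(_ i) + /forallP/(_ i)].
by rewrite (negPf si) (negPf ti) /= => /eqP si' /eqP ti'; rewrite si' ti' eqxx in st.
Qed.

Lemma subcube_neq0 s : subcube s != set0.
Proof.
apply/set0Pn; exists [ffun i => odflt false (s i)].
by apply/in_subcubeP => i b si; rewrite ffunE si.
Qed.

Lemma card_subcube s : #|subcube s| = 2 ^ (n - codim s).
Proof.
(* A subcube is a product of sets of allowed values, with two elements at a star and one
   elsewhere. *)
pose allowed i : pred bool := fun b => (s i == None) || (s i == Some b).
have -> : #|subcube s| = #|(family allowed : simpl_pred {ffun 'I_n -> bool})|.
  by apply: eq_card => x; rewrite inE.
rewrite card_family foldrE big_image /= /codim cardsE.
rewrite (bigID (fun i => s i != None)) /= big1 ?mul1n; last first.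
  move=> i; rewrite /allowed; case: (s i) => [b|] // _; rewrite (@eq_card1 _ b) // => c.
  by rewrite !inE eq_sym.
rewrite (eq_bigr (fun=> 2)) => [|i]; last first.
  by rewrite negbK /allowed => /eqP->; rewrite -[RHS]card_bool; apply: eq_card.
rewrite prod_nat_const; congr (_ ^ _).
have := cardC [pred i | s i != None]; rewrite card_ord => /(canRL (addKn _)) <-.
by apply: eq_card => i; rewrite !inE.
Qed.

Lemma subword_eq s t : subword s t -> codim s = codim t -> s = t.
Proof.
move=> st c; apply: subcube_inj; apply/eqP.
by rewrite eqEcard subcube_subset st !card_subcube c leqnn.
Qed.

Lemma flip_pointK i : involutive (flip_point i).
Proof. by move=> x; apply/ffunP => j; rewrite !ffunE addbA addbb. Qed.

Lemma in_flip_word i s x :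
  (x \in subcube (flip_word i s)) = (flip_point i x \in subcube s).
Proof.
rewrite !inE; apply: eq_forallb => j; rewrite !ffunE.
by case: (s j) => [b|] //=; case: (j == i) (b) (x j) => [] [] [].
Qed.

Lemma codim_flip_word i s : codim (flip_word i s) = codim s.
Proof. by apply: eq_card => j; rewrite !inE ffunE; case: (s j). Qed.

Lemma flip_word_id i s : s i = None -> flip_word i s = s.
Proof.
move=> si; apply/ffunP => j; rewrite ffunE; case: eqP => [->|_]; first by rewrite si.
by case: (s j).
Qed.

(** * Partitions into subcubes *)

Variable F : {set word n}.
Hypothesis partF : subcube_partition F.

Lemma partition_cover x : exists2 s, s \in F & x \in subcube s.
Proof.
have /and3P[/eqP cov _ _] := partF.
have: x \in cover [set subcube s | s in F] by rewrite cov inE.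
by case/bigcupP => _ /imsetP[s sF ->]; exists s.
Qed.

Lemma partition_uniq x s t : s \in F -> t \in F ->
  x \in subcube s -> x \in subcube t -> s = t.
Proof.
move=> sF tF xs xt; have /and3P[_ /trivIsetP triv _] := partF.
apply/subcube_inj/eqP; apply: contraTT xt => st.
have := triv _ _ (imset_f _ sF) (imset_f _ tF) st.
by move/disjointFr => /(_ _ xs) ->.
Qed.

(** Counting points gives [2 ^ n] as [#|F|] times [2 ^ (n - k)]. The bound [k <= n] keeps the
    subtraction from being truncated. *)
Lemma card_partition_homogeneous k :
  (forall s, s \in F -> codim s = k) -> #|F| = 2 ^ k.
Proof.
move=> codF; have [s sF _] := partition_cover [ffun=> false].
have kn : k <= n by rewrite -(codF s sF) /codim -[leqRHS]card_ord max_card.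
have := card_partition partF.
rewrite big_imset /=; last by move=> ? ? _ _; apply: subcube_inj.
rewrite (eq_bigr (fun=> 2 ^ (n - k))) => [|t tF]; last by rewrite card_subcube codF.
rewrite sum_nat_const cardsT card_ffun card_bool card_ord.
rewrite -{1}(subnKC kn) expnD => /eqP.
by rewrite eqn_pmul2r ?expn_gt0 // => /eqP.
Qed.

(** The member covering the flipped point cannot have a star at [i]: it would then contain [x] as
    well, and so be [s]. *)
Lemma opposite_cover i b s x : s \in F -> s i = Some b -> x \in subcube s ->
  exists2 t, t \in F & t i = Some (~~ b) /\ flip_point i x \in subcube t.
Proof.
move=> sF si xs; have [t tF xt] := partition_cover (flip_point i x).
exists t => //; split=> //; case ti: (t i) => [c|].
  have /in_subcubeP/(_ _ _ ti) := xt; have /in_subcubeP/(_ _ _ si) := xs.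
  by rewrite ffunE eqxx => -> <-.
have ts : t = s.
  by apply: (@partition_uniq x) => //; rewrite -(flip_word_id ti) in_flip_word.
by rewrite ts si in ti.
Qed.

(** * Consequences of irreducibility *)

Hypothesis irrF : irreducible F.

(** Irreducibility leaves only [G = F], whose union is the whole cube. *)
Lemma irreducible_block (G : {set word n}) t : G \subset F -> 1 < #|G| ->
  \bigcup_(s in G) subcube s = subcube t -> t = [ffun=> None].
Proof.
move=> GF G1 Gt; have [G2|] := boolP (#|G| < #|F|).
  by case: (irrF GF); [rewrite G1 | exists t].
rewrite -leqNgt => FG; have {}GF : G = F by apply/eqP; rewrite eqEcard GF.
apply: subcube_inj; rewrite -Gt GF; apply/setP => x.
have [s sF xs] := partition_cover x.
rewrite (introT bigcupP) ?(introT (in_subcubeP _ _)) //; last by exists s.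
by move=> i b; rewrite ffunE.
Qed.

(** A subcube that every member either lies in or avoids is the union of the members inside it. This
    criterion speaks of single words instead of subfamilies, which makes it usable in a search. *)
Lemma irreducible_subcube t s1 s2 :
  (forall s, s \in F -> subword s t \/ ~~ compatible s t) ->
  s1 \in F -> s2 \in F -> s1 != s2 -> subword s1 t -> subword s2 t ->
  t = [ffun=> None].
Proof.
move=> Ft s1F s2F s12 s1t s2t.
apply: (@irreducible_block [set s in F | subword s t]).
- by apply/subsetP => s; rewrite inE => /andP[].
- by apply/card_gt1P; exists s1, s2; split=> //; rewrite inE ?s1F ?s2F.
apply/setP => x; apply/bigcupP/idP => [[s]|xt].
  by rewrite inE -subcube_subset => /andP[_ /subsetP]; apply.
have [s sF xs] := partition_cover x; exists s => //; rewrite inE sF.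
by have [//|] := Ft s sF; rewrite -disjoint_subcube => /disjointFr/(_ xs); rewrite xt.
Qed.

Variable k : nat.
Hypothesis k_gt1 : 1 < k.
Hypothesis codF : forall s, s \in F -> codim s = k.

(** Together, [s] and its mirror image fill the subcube obtained by putting a star at [i], which is
    not the whole cube because [k > 1]. *)
Lemma flip_word_notin i b s : s \in F -> s i = Some b -> flip_word i s \notin F.
Proof.
move=> sF si; apply/negP => fF.
pose t : word n := [ffun j => if j == i then None else s j].
have fs : s != flip_word i s.
  by apply/eqP => /ffunP/(_ i); rewrite ffunE eqxx si; case: (b).
suff t0 : t = [ffun=> None].
  have: codim s <= 1.
    rewrite -(cards1 i); apply/subset_leq_card/subsetP => j; rewrite !inE.
    by move/ffunP: t0 => /(_ j); rewrite !ffunE; case: eqP => // _ ->.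
  by rewrite codF // leqNgt k_gt1.
apply: (@irreducible_block [set s; flip_word i s]).
- by apply/subsetP => u; rewrite !inE => /pred2P[] ->.
- by rewrite cards2 fs.
rewrite bigcup_setU !big_set1; apply/setP => x; rewrite inE in_flip_word.
apply/orP/in_subcubeP => [[/in_subcubeP xs | /in_subcubeP xs] j c | xt].
- by rewrite ffunE; case: eqP => // _ /xs.
- by rewrite ffunE; case: eqP => // /eqP ji /xs; rewrite ffunE (negPf ji).
have [xi|xi] := eqVneq (x i) b; [left|right]; apply/in_subcubeP => j c sj.
  have [ji|ji] := eqVneq j i; last by apply: xt; rewrite ffunE (negPf ji).
  by move: sj; rewrite ji si xi => -[].
rewrite ffunE; have [ji|ji] := eqVneq j i.
  by move: sj xi; rewrite ji si => -[->]; case: (x i) (c) => [] [].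
by apply: xt; rewrite ffunE (negPf ji).
Qed.

(* If only [A] and [B] have value [b] at [i], they conflict at some [l], and
   the members with value [~~ b], flipped at [i], cover the same points.  Each
   of these has a star at [l]: otherwise it lies inside [A] or [B] and, having
   the same codimension, equals it.  So the union of [A] and [B] is invariant
   under flipping [l], i.e. [A] flipped at [l] is [B]. *)
Lemma card_value_gt2 i b :
  (exists2 s, s \in F & s i != None) -> 2 < #|[set s in F | s i == Some b]|.
Proof.
move=> [s0 s0F s0i]; set Fb := [set s in F | _].
have no_sub D A : D \in F -> D i = Some (~~ b) -> A \in Fb ->
    ~~ (subcube (flip_word i D) \subset subcube A).
  rewrite inE => DF Di /andP[AF _]; rewrite subcube_subset; apply/negP.
  move/subword_eq; rewrite codim_flip_word !codF // => /(_ erefl) DA.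
  by have := flip_word_notin DF Di; rewrite DA AF.
have covered D x : D \in F -> D i = Some (~~ b) ->
    x \in subcube (flip_word i D) -> exists2 A, A \in Fb & x \in subcube A.
  rewrite in_flip_word => DF Di /(opposite_cover DF Di)[A AF [Ai]].
  by rewrite flip_pointK => xA; exists A; rewrite // inE AF Ai negbK eqxx.
have [D0 D0F D0i] : exists2 D, D \in F & D i = Some (~~ b).
  case e: (s0 i) s0i => [c|] // _; have [cb|cb] := eqVneq c (~~ b).
    by exists s0; rewrite // e cb.
  have /set0Pn[x xs] := subcube_neq0 s0.
  have [t tF [ti _]] := opposite_cover s0F e xs; exists t => //.
  by rewrite ti; case: (b) (c) cb => [] [].
have /set0Pn[x0 x0D0] := subcube_neq0 (flip_word i D0).
have [A AFb x0A] := covered _ _ D0F D0i x0D0.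
(* The mirror image of [D0] does not fit inside [A], so some point of it requires a second member
   [B]. *)
have /subsetPn[y yD0 yA] := no_sub _ _ D0F D0i AFb.
have [B BFb yB] := covered _ _ D0F D0i yD0.
have AB : A != B by apply: contraNneq yA => ->.
rewrite ltnNge; apply/negP => Fb2.
have FbE : [set A; B] = Fb.
  apply/eqP; rewrite eqEcard cards2 AB Fb2 andbT.
  by apply/subsetP => u; rewrite in_set2 => /pred2P[] ->.
have [[AF Ai] [BF Bi]] : (A \in F /\ A i = Some b) /\ (B \in F /\ B i = Some b).
  by move: AFb BFb; rewrite !inE => /andP[-> /eqP ->] /andP[-> /eqP ->].
have [l [c [Al Bl]]] : exists l c, A l = Some c /\ B l = Some (~~ c).
  have: [disjoint subcube A & subcube B].
    apply/pred0P => x /=; apply/negP => /andP[xA xB].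
    by rewrite (partition_uniq AF BF xA xB) eqxx in AB.
  rewrite disjoint_subcube => /forallPn[l]; rewrite !negb_or; exists l.
  case: (A l) (B l) p => [c|] [d|] //= cd; exists c; split=> //.
  by case: c d cd => [] [].
have invA x : x \in subcube A -> flip_point l x \in subcube B.
  move=> xA; have [D DF [Di xD]] := opposite_cover AF Ai xA.
  rewrite -in_flip_word in xD.
  have inAB y' : y' \in subcube (flip_word i D) ->
      (y' \in subcube A) || (y' \in subcube B).
    by case/(covered _ _ DF Di) => u; rewrite -FbE !inE => /pred2P[] -> ->; rewrite ?orbT.
  have Dl : flip_word i D l = None.
    case e: (flip_word i D l) => [d|] //.
    have [dc|dc] := eqVneq d c.
      case/subsetPn: (no_sub D A DF Di AFb) => z zD.
      case/orP: (inAB z zD) => [->//|zB].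
      have /in_subcubeP/(_ _ _ e) := zD; have /in_subcubeP/(_ _ _ Bl) := zB.
      by rewrite dc => ->; case: (c).
    case/subsetPn: (no_sub D B DF Di BFb) => z zD.
    case/orP: (inAB z zD) => [zA|->//].
    have /in_subcubeP/(_ _ _ e) := zD; have /in_subcubeP/(_ _ _ Al) := zA.
    by move=> -> cd; rewrite cd eqxx in dc.
  have := xD; rewrite -(flip_word_id Dl) in_flip_word => /inAB/orP[|//].
  move/in_subcubeP/(_ _ _ Al); move/in_subcubeP/(_ _ _ Al): xA.
  by rewrite ffunE eqxx => ->; case: (c).
have /subword_eq : subword (flip_word l A) B.
  rewrite -subcube_subset; apply/subsetP => x.
  by rewrite in_flip_word => /invA; rewrite flip_pointK.
rewrite codim_flip_word !codF // => /(_ erefl) BA.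
by have := flip_word_notin AF Al; rewrite BA BF.
Qed.
End Subcubes.

(** * The length is 4 *)

Lemma homogeneous3_length n (F : {set word n}) :
  irreducible F -> homogeneous 3 F -> n = 4.
Proof.
move=> irrF [partF tightF codF]; have F8 := card_partition_homogeneous partF codF.
have n_le4 : n <= 4.
  (* Double counting of the pairs of a member and a coordinate it mentions: there are
     [8 * 3 = 6 * 4] of them, and at least [3 + 3] for each coordinate. *)
  rewrite -(@leq_pmul2l 6) // -[6 * 4](_ : \sum_(s in F) codim s = _); last first.
    by rewrite (eq_bigr (fun=> 3)) // sum_nat_const F8.
  have -> : \sum_(s in F) codim s = \sum_(i < n) #|[set s in F | s i != None]|.
    rewrite (eq_bigr (fun s : word n => \sum_(i < n) (s i != None : nat))).
      rewrite exchange_big; apply: eq_bigr => i _ /=.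
      by rewrite -big_mkcondr sum1dep_card.
    by move=> s _; rewrite -big_mkcond /= sum1dep_card.
  rewrite -[n in 6 * n]card_ord mulnC -sum_nat_const leq_sum // => i _.
  have Fi b := card_value_gt2 partF irrF (isT : 1 < 3) codF b (tightF i).
  apply: leq_trans (leq_add (Fi false) (Fi true)) _.
  rewrite -cardsUI (_ : _ :&: _ = set0) ?cards0 ?addn0.
    apply/subset_leq_card/subsetP => s; rewrite !inE -andb_orr => /andP[->].
    by case: (s i).
  by apply/setP => s; rewrite !inE; case: (s i) => [[]|]; rewrite ?andbF.
apply/eqP; rewrite eqn_leq n_le4 ltnNge; apply/negP => n_le3.
have [s sF _] := partition_cover partF [ffun=> false].
(* With at most 3 coordinates and codimension 3 no member has a star. The mirror image of [s] is
   then a single point, and the member covering it is equal to it, against [flip_word_notin]. *)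
have full t j : t \in F -> t j != None.
  move=> tF; suff: j \in [set j | t j != None] by rewrite inE.
  suff -> : [set j | t j != None] = setT by rewrite inE.
  by apply/eqP; rewrite eqEcard subsetT cardsT card_ord -/(codim t) codF.
have /card_gt0P[i] : 0 < codim s by rewrite codF.
rewrite inE; case si: (s i) => [b|] // _.
have /set0Pn[x xs] := subcube_neq0 (flip_word i s).
have [t tF xt] := partition_cover partF x.
have /negP := flip_word_notin partF irrF (isT : 1 < 3) codF sF si; apply.
suff -> : flip_word i s = t by [].
apply/ffunP => j; have := full s j sF; have := full t j tF.
case tj: (t j) => [c|] //; case fj: (flip_word i s j) => [d|] _ sj.
  by move/in_subcubeP/(_ _ _ fj): xs => <-; move/in_subcubeP/(_ _ _ tj): xt => ->.
by move: fj sj; rewrite ffunE; case: (s j).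
Qed.

(** * Exact-cover search *)

(* Finite functions do not compute, so the search represents words and points
   by their lists of values [codom s]. *)
Section Codes.
Variable n : nat.
Implicit Types (s t : word n) (x : {ffun 'I_n -> bool}) (v w : seq (option bool)).

Definition seq_fits w (p : seq bool) : bool :=
  all2 (fun o c => (o == None) || (o == Some c)) w p.

Definition seq_compatible v w : bool :=
  all2 (fun o o' => [|| o == None, o' == None | o == o']) v w.

Definition seq_subword v w : bool :=
  all2 (fun o o' => (o' == None) || (o' == o)) v w.

Definition seq_codim w : nat := count (predC1 None) w.

Definition seq_perm_flip (p : seq nat) (b : seq bool) w : seq (option bool) :=
  [seq omap (addb (nth false b i)) (nth None w (nth 0 p i)) | i <- iota 0 n].

Fixpoint lists T (alphabet : seq T) m : seq (seq T) :=
  if m is m'.+1 then [seq a :: l | a <- alphabet, l <- lists alphabet m']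
  else [:: [::]].

Definition words := lists [:: None; Some false; Some true] n.

Definition points := lists [:: false; true] n.

(* All ways to extend [L] by pairwise disjoint elements of [ws], each added in
   order to cover the first point of [ps] left uncovered. *)
Fixpoint extensions (ws : seq (seq (option bool))) (ps : seq (seq bool)) L :=
  if ps is p :: ps' then
    if has (seq_fits^~ p) L then extensions ws ps' L
    else flatten [seq extensions ws ps' (w :: L) |
                  w <- ws & seq_fits w p && ~~ has (seq_compatible w) L]
  else [:: L].

(* Any family [G] whose union is the subcube [w] consists of the members
   contained in [w], and all other members are then disjoint from [w]. *)
Definition decomposable_by L w : bool :=
  [&& has (predC1 None) w,
      all (fun v => seq_subword v w || ~~ seq_compatible v w) L &
      1 < size (undup [seq v <- L | seq_subword v w])].

(** * Translation between finite functions and lists *)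

Lemma nth_codom_ord T (a : T) (f : {ffun 'I_n -> T}) (i : 'I_n) :
  nth a (codom f) i = f i.
Proof.
by rewrite codomE (nth_map i) ?size_enum_ord // nth_ord_enum.
Qed.

Lemma codom_inj (T : eqType) : injective (fun f : {ffun 'I_n -> T} => codom f).
Proof.
move=> f g fg; apply/ffunP => i.
by have := congr1 (fun l => nth (f i) l i) fg; rewrite /= !nth_codom_ord.
Qed.

Lemma codom_surj (T : eqType) (l : seq T) : size l = n ->
  exists f : {ffun 'I_n -> T}, codom f = l.
Proof.
move=> ln; case: l ln => [|a l] ln.
  have f : {ffun 'I_n -> T} by apply: finfun => -[i]; rewrite -ln.
  by exists f; apply: size0nil; rewrite size_codom card_ord.
exists [ffun i : 'I_n => nth a (a :: l) i]; apply: (@eq_from_nth _ a).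
  by rewrite size_codom card_ord.
rewrite size_codom card_ord => i i_n.
by rewrite (nth_codom_ord a _ (Ordinal i_n)) ffunE.
Qed.

Lemma all2_codom T1 T2 (r : T1 -> T2 -> bool) (f : {ffun 'I_n -> T1})
    (g : {ffun 'I_n -> T2}) :
  all2 r (codom f) (codom g) = [forall i, r (f i) (g i)].
Proof.
rewrite !codomE.
have -> : [forall i, r (f i) (g i)] = all (fun i => r (f i) (g i)) (enum 'I_n).
  apply/forallP/allP => [rfg i _ //|rfg i]; apply: rfg; exact: mem_enum.
by elim: (enum 'I_n) => //= i e ->.
Qed.

Lemma seq_fitsE s x : seq_fits (codom s) (codom x) = (x \in subcube s).
Proof. by rewrite /seq_fits all2_codom inE. Qed.

Lemma seq_compatibleE s t : seq_compatible (codom s) (codom t) = compatible s t.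
Proof. exact: all2_codom. Qed.

Lemma seq_subwordE s t : seq_subword (codom s) (codom t) = subword s t.
Proof. exact: all2_codom. Qed.

Lemma seq_codimE s : seq_codim (codom s) = codim s.
Proof.
rewrite /seq_codim codomE count_map /codim cardsE cardE size_filter.
by rewrite enumT.
Qed.

Lemma lists_codom (T : eqType) (alphabet : seq T) (f : {ffun 'I_n -> T}) :
  (forall a, a \in alphabet) -> codom f \in lists alphabet n.
Proof.
move=> full; have : size (codom f) = n by rewrite size_codom card_ord.
elim: n (codom f : seq T) => [|m IH] [|a l] //= [lm].
by apply/allpairsP; exists (a, l); split; rewrite //= IH.
Qed.

Lemma size_lists (T : eqType) (alphabet : seq T) m l :
  l \in lists alphabet m -> size l = m.
Proof.
elim: m l => [|m IH] l /=; first by rewrite inE => /eqP ->.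
by case/allpairsP=> -[a l'] [_ /IH <- ->].
Qed.

Lemma codom_words s : codom s \in words.
Proof. by apply: lists_codom => -[[]|]. Qed.

Lemma codom_points x : codom x \in points.
Proof. by apply: lists_codom => -[]. Qed.

Lemma codom_perm_flip (p : 'S_n) (pl : seq nat) (b : {ffun 'I_n -> bool}) s :
  (forall i : 'I_n, nth 0 pl i = p i) ->
  codom (perm_flip p b s) = seq_perm_flip pl (codom b) (codom s).
Proof.
move=> plE; rewrite /seq_perm_flip -val_enum_ord -map_comp codomE.
by apply: eq_map => i /=; rewrite ffunE plE !nth_codom_ord.
Qed.

Lemma perm_of_seq (pl : seq nat) : perm_eq pl (iota 0 n) ->
  exists p : 'S_n, forall i : 'I_n, nth 0 pl i = p i.
Proof.
move=> pl_iota; have szl : size pl = n by rewrite (perm_size pl_iota) size_iota.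
have lt i : i < n -> nth 0 pl i < n.
  by rewrite -{1}szl => /(mem_nth 0); rewrite (perm_mem pl_iota) mem_iota.
pose f (i : 'I_n) := Ordinal (lt i (ltn_ord i)).
have f_inj : injective f.
  move=> i j [] /eqP; rewrite nth_uniq ?szl // => [/eqP /val_inj //|].
  by rewrite (perm_uniq pl_iota) iota_uniq.
by exists (perm f_inj) => i; rewrite permE.
Qed.

Lemma codes_partition (F : {set word n}) L :
  (forall w, w \in L <-> exists2 s, s \in F & w = codom s) ->
  all (fun p => has (seq_fits^~ p) L) points ->
  {in L &, forall v w, v != w -> ~~ seq_compatible v w} ->
  subcube_partition F.
Proof.
move=> LF /allP Lcov Linc; apply/and3P; split.
- rewrite -subTset; apply/subsetP => x _.
  have /hasP[w /LF[s sF ->]] := Lcov _ (codom_points x).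
  by rewrite seq_fitsE => xs; apply/bigcupP; exists (subcube s); rewrite ?imset_f.
- apply/trivIsetP => _ _ /imsetP[s sF ->] /imsetP[t tF ->] st.
  rewrite disjoint_subcube -seq_compatibleE; apply: Linc; [by apply/LF; exists s | by apply/LF; exists t |].
  by apply: contraNneq st => /codom_inj ->.
apply/imsetP => -[s _ s0]; by have := subcube_neq0 s; rewrite -s0 eqxx.
Qed.

(** * Completeness of the search and of the irreducibility test *)

Variable F : {set word n}.
Hypothesis partF : subcube_partition F.

Lemma partition_incompatible s t :
  s \in F -> t \in F -> s != t -> ~~ compatible s t.
Proof.
move=> sF tF st; rewrite -disjoint_subcube; apply/pred0P => x /=.
apply/negP => /andP[xs xt]; by rewrite (partition_uniq partF sF tF xs xt) eqxx in st.
Qed.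

(** One branch of the search stays inside [F]: at each uncovered point it picks the member of [F]
    containing that point, which is incompatible with the members picked before. *)
Lemma extensionsP ws ps L :
  (forall s, s \in F -> codom s \in ws) ->
  all (fun p => size p == n) ps ->
  (forall w, w \in L -> exists2 s, s \in F & w = codom s) ->
  exists L', [/\ L' \in extensions ws ps L, {subset L <= L'},
    forall w, w \in L' -> exists2 s, s \in F & w = codom s &
    {in ps, forall p, has (seq_fits^~ p) L'}].
Proof.
move=> Fws; elim: ps L => [|p ps IH] L /=.
  by exists L; split=> //; rewrite inE.
case/andP=> /eqP/codom_surj[x xp] szps LF; case: ifP => [pL|/negbT pL].
  have [L' [L'e LL' L'F L'ps]] := IH L szps LF; exists L'; split=> // q.
  rewrite inE => /predU1P[->|/L'ps //].
  by case/hasP: pL => w /LL' wL' wp; apply/hasP; exists w.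
have [s sF xs] := partition_cover partF x.
have sp : seq_fits (codom s) p by rewrite -xp seq_fitsE.
have [|L' [L'e LL' L'F L'ps]] := IH (codom s :: L : seq (seq (option bool))) szps.
  by move=> w; rewrite inE => /predU1P[->|/LF //]; exists s.
exists L'; split=> //.
- apply/flatten_mapP; exists (codom s : seq _) => //.
  rewrite mem_filter sp Fws // andbT /=; apply/hasPn => v vL; have [t tF vt] := LF v vL.
  rewrite vt in vL *; rewrite seq_compatibleE partition_incompatible //.
  by apply: contraNneq pL => st; apply/hasP; exists (codom t) => //; rewrite -st.
- by move=> w wL; apply: LL'; rewrite inE wL orbT.
move=> q; rewrite inE => /predU1P[->|/L'ps //].
by apply/hasP; exists (codom s) => //; apply: LL'; rewrite inE eqxx.
Qed.

(** The list found lies inside [F] and covers all points. No member is missing from it, since each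
    contains a point and is the only member that does. *)
Lemma partition_extension ws : (forall s, s \in F -> codom s \in ws) ->
  exists2 L, L \in extensions ws points [::] &
    forall w, w \in L <-> exists2 s, s \in F & w = codom s.
Proof.
move=> Fws; have szp : all (fun p => size p == n) points.
  by apply/allP => p /size_lists ->.
have [//|L [Le _ LF Lp]] := extensionsP Fws szp (L := [::]).
exists L => // w; split=> [/LF //|[s sF ->]].
have /set0Pn[x xs] := subcube_neq0 s.
have /hasP[v vL] := Lp _ (codom_points x); have [t tF vt] := LF v vL.
move: vL; rewrite vt => vL; rewrite seq_fitsE => xt.
by rewrite (partition_uniq partF sF tF xs xt).
Qed.

Lemma irreducible_indecomposable L w : irreducible F ->
  (forall w, w \in L <-> exists2 s, s \in F & w = codom s) ->
  w \in words -> ~~ decomposable_by L w.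
Proof.
move=> irrF LF /size_lists/codom_surj[t <-]; apply/negP => /and3P[t0 /allP Lt].
case e: (undup _) => [|v1 [|v2 vs]] // _.
have := undup_uniq [seq v <- L | seq_subword v (codom t)].
rewrite e /= inE => /andP[/norP[v12 _] _].
have inL v : v \in [:: v1, v2 & vs] -> exists2 s, s \in F & v = codom s /\ subword s t.
  rewrite -e mem_undup mem_filter => /andP[vt /LF[s sF vs']]; exists s => //.
  by rewrite -seq_subwordE -vs'.
have [|s1 s1F [v1s1 s1t]] := inL v1; first by rewrite inE eqxx.
have [|s2 s2F [v2s2 s2t]] := inL v2; first by rewrite !inE eqxx orbT.
have s12 : s1 != s2 by apply: contraNneq v12 => s12; rewrite v1s1 v2s2 s12.
have {}Lt s : s \in F -> subword s t \/ ~~ compatible s t.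
  move=> sF; apply/orP; rewrite -seq_subwordE -seq_compatibleE; apply: Lt.
  by apply/LF; exists s.
have tE := irreducible_subcube partF irrF Lt s1F s2F s12 s1t s2t.
by case/hasP: t0 => o /codomP[i ->]; rewrite tE ffunE.
Qed.

(** If a subfamily [G] has a subcube as union, members outside [G] are disjoint from that subcube,
    so its word passes the test. Irreducibility thus reduces to a check of finitely many words. *)
Lemma indecomposable_irreducible L :
  (forall w, w \in L <-> exists2 s, s \in F & w = codom s) ->
  ~~ has (decomposable_by L) words -> irreducible F.
Proof.
move=> FL /hasPn/= Lw G GF /andP[G1 GltF] [t Gt].
have Gsub s : s \in G -> subword s t.
  by move=> sG; rewrite -subcube_subset -Gt bigcup_sup.
have /negP := Lw _ (codom_words t); apply; apply/and3P; split.
(* If [t] had only stars, [G] would cover every point and therefore contain all of [F]. *)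
- apply: contraLR GltF => /hasPn t0; rewrite -leqNgt.
  apply/subset_leq_card/subsetP => s sF; have [x xs] := set0Pn _ (subcube_neq0 s).
  have: x \in subcube t.
    apply/in_subcubeP => i b ti.
    by have := t0 _ (codom_f t i); rewrite /= ti.
  rewrite -Gt => /bigcupP[u uG xu]; rewrite (partition_uniq partF sF _ xs xu) //.
  exact: (subsetP GF).
- apply/allP => _ /FL[s sF ->]; rewrite seq_subwordE seq_compatibleE.
  have [/Gsub -> //|sG] := boolP (s \in G).
  rewrite -disjoint_subcube; apply/orP; right; apply/pred0P => x /=; apply/negP => /andP[xs].
  rewrite -Gt => /bigcupP[u uG xu].
  by rewrite (partition_uniq partF sF (subsetP GF u uG) xs xu) uG in sG.
rewrite (leq_trans G1) // cardE -(size_map (fun s : word n => codom s : seq _)).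
apply: uniq_leq_size; first by rewrite map_inj_uniq ?enum_uniq //; apply: codom_inj.
move=> _ /mapP[s + ->]; rewrite mem_enum => sG.
rewrite mem_undup mem_filter seq_subwordE Gsub //=; apply/FL; exists s => //.
exact: (subsetP GF).
Qed.
End Codes.

(** * The partition of length 4 and its uniqueness *)

Definition members4 : seq (seq (option bool)) :=
  let o := Some false in let i := Some true in
  [:: [:: None; o; o; o]; [:: o; None; o; i]; [:: o; o; i; None];
      [:: o; i; None; o]; [:: None; i; i; i]; [:: i; o; None; i];
      [:: i; None; i; o]; [:: i; i; o; None]].

(** A perfect matching of the 4-cube: in each of the four directions it has two edges, exchanged by
    flipping all coordinates. Each coordinate is thus mentioned exactly 6 times, as the counting
    bound requires. *)
Definition partition4 : {set word 4} :=
  [set s : word 4 | (codom s : seq _) \in members4].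

Lemma partition4P w :
  w \in members4 <-> exists2 s : word 4, s \in partition4 & w = codom s.
Proof.
split=> [wL|[s]]; last by rewrite inE => sL ->.
have /codom_surj[s sw] : size w = 4.
  by apply/eqP; apply: (allP (_ : all (fun w => size w == 4) members4)).
by exists s; rewrite // inE sw.
Qed.

Lemma partition4_homogeneous : homogeneous 3 partition4.
Proof.
split.
- apply: codes_partition partition4P _ _; first by vm_compute.
  move=> v w vL wL; apply/implyP.
  apply: (allrelP (_ : allrel (fun v w => (v != w) ==> ~~ seq_compatible v w)
    members4 members4)) => //.
- move=> i; have: has (fun w => nth None w i != None) members4.
    by case: i => [[|[|[|[|]]]]].
  by case/hasP=> _ /partition4P[s sF ->]; rewrite nth_codom_ord; exists s.
move=> s; rewrite inE -seq_codimE => sL; apply/eqP.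
exact: (allP (_ : all (fun w => seq_codim w == 3) members4)).
Qed.

Lemma partition4_irreducible : irreducible partition4.
Proof.
have [partF _ _] := partition4_homogeneous.
by apply: (indecomposable_irreducible partF partition4P); vm_compute.
Qed.

(** The classification by computation: each exact cover by codimension-3 words that survives the
    irreducibility test is matched with one of the [24 * 16] symmetric images of [members4]. The
    elements of [points 4] act as flip vectors here, and mutual inclusion compares the lists
    regardless of order. *)
Lemma extensions_perm_flip :
  all (fun L => has (fun p => has (fun b =>
        let L' := map (seq_perm_flip 4 p b) members4 in
        all (mem L) L' && all (mem L') L) (points 4))
      (permutations (iota 0 4)))
    [seq L <- extensions [seq w <- words 4 | seq_codim w == 3] (points 4) [::]
       | ~~ has (decomposable_by L) (words 4)].
Proof. by vm_compute. Qed.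

Lemma partition4_unique (F : {set word 4}) :
  irreducible F -> homogeneous 3 F -> equivalent partition4 F.
Proof.
move=> irrF [partF _ codF].
have [|L Le LF] := @partition_extension _ F partF [seq w <- words 4 | seq_codim w == 3].
  by move=> s sF; rewrite mem_filter codom_words seq_codimE codF.
have /(allP extensions_perm_flip)/hasP[pl pl4 /hasP[bl bl4]] :
    L \in [seq L <- extensions [seq w <- words 4 | seq_codim w == 3] (points 4) [::]
       | ~~ has (decomposable_by L) (words 4)].
  rewrite mem_filter Le andbT; apply/hasPn => w.
  exact: (irreducible_indecomposable partF irrF LF).
have [|p plE] := @perm_of_seq 4 pl; first by rewrite -mem_permutations.
have /codom_surj[b <-] := size_lists bl4.
case/andP=> /allP L'L /allP LL'; exists p, b; apply/setP => s; apply/idP/imsetP => [sF|].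
  have /LL'/mapP[_ /partition4P[t t4 ->]] : (codom s : seq _) \in L by apply/LF; exists s.
  by rewrite -(codom_perm_flip _ _ plE) => /codom_inj ->; exists t.
case=> t; rewrite inE => t4 ->.
have /LF[u uF] : (codom (perm_flip p b t) : seq _) \in L.
  by apply: L'L; rewrite (codom_perm_flip _ _ plE) map_f.
by move/codom_inj ->.
Qed.

Theorem theorem2p60 :
  (forall (n : nat) (F : {set word n}),
     irreducible F -> homogeneous 3 F -> n = 4) /\
  (exists F : {set word 4},
     [/\ irreducible F, homogeneous 3 F &
         forall F' : {set word 4},
           irreducible F' -> homogeneous 3 F' -> equivalent F F']).

Proof.
split; first exact: homogeneous3_length.
exists partition4; split; [exact: partition4_irreducible |
  exact: partition4_homogeneous | exact: partition4_unique].
Qed.
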